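(* Let $G$ be a finite abelian group and let $\mathcal D=\{D_i : i=0,1,2,3\}$ be a difference family of type $H$ in $G$. (1) If $\mathcal D$ satisfies (d3), and there exists a difference family of type $H_4^\ast$ in $G$ satisfying (c1), then there exists a difference family of type $H_4^\ast$ in $G\times \mathbb Z_2$. (2) If $\mathcal D$ is symmetric and satisfies (d3), and there exists a difference family of type $H_2^\ast$ in $G$, then there exists a difference family of type $H_4^\ast$ in $G\times \mathbb Z_3$. (3) If $\mathcal D$ is symmetric and satisfies (d2) and (d5), then there exists a difference family of type $H_4^\ast$ in $G\times \mathbb Z_5$. (4) If $\mathcal D$ is symmetric and satisfies (d2), and there exists a symmetric difference family $\mathcal S$ of type $H$ satisfying (d1) and (d2) in a finite abelian group $N$, then there exists a symmetric difference family of type $H_8^\ast$ in $G\times N$.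
   Context: All groups are finite, abelian and written additively. For a group $G$, $0_G$ is its identity and $G^\ast=G\setminus\{0_G\}$. For $D\subseteq G$ put $D^{(-1)}=\{-x:x\in D\}$ and $\overline D=G^\ast\setminus D$. A subset $D$ of $G$ is identified with the element $\sum_{x\in D}x$ of the group ring $\mathbb Z[G]$ (so $G$ also denotes $\sum_{x\in G}x$); sums and products of subsets in displayed identities are taken in $\mathbb Z[G]$. For an integer $\lambda$, $\lambda\cdot 0_G$ is the element of $\mathbb Z[G]$ with coefficient $\lambda$ at $0_G$ and $0$ elsewhere. Families are indexed (ordered; blocks may coincide). A family $\mathcal B=\{B_i:i=1,\dots,\ell\}$ of subsets of $G$ with $|B_i|=k_i$ is a difference family with parameter $\lambda\in\mathbb Z$ if $\sum_{i=1}^{\ell}B_iB_i^{(-1)}=\lambda G+(\sum_{i=1}^{\ell}k_i-\lambda)\cdot 0_G$. It is symmetric if $B_i=B_i^{(-1)}$ for every $i$. For $\ell\in\{2,4,8\}$, a difference family with $\ell$ blocks is of type $H_\ell^\ast$ if $\lambda=\sum_{i}k_i-\ell(|G|+1)/4$. A difference family with $4$ blocks is of type $H$ if $\lambda=\sum_i k_i-|G|$. Conditions on a family $\{D_0,D_1,D_2,D_3\}$ of subsets of $G$: (c1) $D_0D_2^{(-1)}+D_2D_0^{(-1)}+D_1D_3^{(-1)}+D_3D_1^{(-1)}=(\sum_{i=0}^3|D_i|-|G|)\,G$. (d1) $0_G\notin\bigcup_{i=0}^3D_i$. (d2) There are subsets $E_0,E_1$ of $G^\ast$ such that $D_0+D_1-D_2-D_3=E_0-\overline{E}_0$,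 $D_0+D_3-D_1-D_2=E_1-\overline{E}_1$ in $\mathbb Z[G]$, and $E_0,E_1,\overline{E}_0,\overline{E}_1$ form a difference family of type $H_4^\ast$ in $G$. (d3) $D_0D_2^{(-1)}+D_2D_0^{(-1)}+D_1D_3^{(-1)}+D_3D_1^{(-1)}=(\sum_{i=0}^3|D_i|-|G|+1)\,G$. (d5) $|D_0|+|D_3|=|D_1|+|D_2|$. *)

(* Defs.v *)
From HB Require Import structures.
From mathcomp Require Import all_boot all_order all_algebra.

Set Implicit Arguments.
Unset Strict Implicit.
Unset Printing Implicit Defensive.

Import GRing.Theory.
Local Open Scope ring_scope.

(* MathComp has the componentwise zmodType and finType structures on products *)
(* but does not join them.                                                   *)
HB.instance Definition _ (G H : finZmodType) := Finite.on (G * H)%type.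

(* The integral group ring Z[G] of a finite abelian group G written           *)
(* additively. This is a separate type from {ffun G -> int}, on which         *)
(* MathComp's canonical product is pointwise rather than convolution.         *)
Record gring (G : finZmodType) := GRingElt { gcoef : {ffun G -> int} }.

HB.instance Definition _ (G : finZmodType) := [isNew for @gcoef G].
HB.instance Definition _ (G : finZmodType) := [Choice of gring G by <:].

Section GroupRing.
Variable G : finZmodType.
Implicit Types a b c : gring G.

Definition gr_zero : gring G := GRingElt 0.
Definition gr_opp a : gring G := GRingElt (- gcoef a).
Definition gr_add a b : gring G := GRingElt (gcoef a + gcoef b).
Definition gr_one : gring G := GRingElt [ffun x => (x == 0)%:R].
Definition gr_mul a b : gring G :=
  GRingElt [ffun x => \sum_y gcoef a y * gcoef b (x - y)].

Fact gr_addA : associative gr_add.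
Proof. by move=> a b c; apply: val_inj; exact: addrA. Qed.
Fact gr_addC : commutative gr_add.
Proof. by move=> a b; apply: val_inj; exact: addrC. Qed.
Fact gr_add0 : left_id gr_zero gr_add.
Proof. by move=> a; apply: val_inj; exact: add0r. Qed.
Fact gr_addN : left_inverse gr_zero gr_opp gr_add.
Proof. by move=> a; apply: val_inj; exact: addNr. Qed.

HB.instance Definition _ :=
  GRing.isZmodule.Build (gring G) gr_addA gr_addC gr_add0 gr_addN.

Fact gr_mulC : commutative gr_mul.
Proof.
move=> a b; apply: val_inj; apply/ffunP => x; rewrite !ffunE.
rewrite (reindex_inj (inj_comp (addrI x) oppr_inj)) /=.
by apply: eq_bigr => y _; rewrite opprD opprK addrA subrr add0r mulrC.
Qed.

Fact gr_mulA : associative gr_mul.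
Proof.
move=> a b c; apply: val_inj; apply/ffunP => x; rewrite !ffunE.
under eq_bigr do rewrite ffunE big_distrr /=.
under [RHS]eq_bigr do rewrite ffunE big_distrl /=.
rewrite [RHS]exchange_big /=; apply: eq_bigr => y _.
rewrite [RHS](reindex_inj (addIr y)) /=; apply: eq_bigr => z _.
by rewrite addrK mulrA opprD addrA addrAC.
Qed.

Fact gr_mul1 : left_id gr_one gr_mul.
Proof.
move=> a; apply: val_inj; apply/ffunP => x; rewrite !ffunE.
rewrite (bigD1 0) //= big1 ?addr0 => [|y /negPf y0]; rewrite ffunE.
  by rewrite eqxx mul1r subr0.
by rewrite y0 mul0r.
Qed.

Fact gr_mulDl : left_distributive gr_mul gr_add.
Proof.
move=> a b c; apply: val_inj; apply/ffunP => x; rewrite !ffunE -big_split /=.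
by apply: eq_bigr => y _; rewrite ffunE mulrDl.
Qed.

Fact gr_one_neq0 : gr_one != 0.
Proof.
apply/eqP => /(congr1 (fun a => gcoef a 0)).
by rewrite !ffunE eqxx.
Qed.

HB.instance Definition _ :=
  GRing.Zmodule_isComNzRing.Build (gring G)
    gr_mulA gr_mulC gr_mul1 gr_mulDl gr_one_neq0.

Implicit Types D : {set G}.

Definition gset D : gring G := GRingElt [ffun x => (x \in D)%:R].

Definition setN D : {set G} := [set - x | x in D].

(* The complement is taken in G^* = G \ {0}. *)
Definition cobar D : {set G} := [set~ 0] :\: D.

Section Family.
Variable l : nat.
Implicit Types B : 'I_l -> {set G}.

Definition difference_family B (lam : int) : Prop :=
  \sum_i gset (B i) * gset (setN (B i)) =
    gset setT *~ lam + gset [set 0] *~ ((\sum_i #|B i|)%N%:Z - lam).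

Definition symmetric_family B : Prop := forall i, B i = setN (B i).

(* Used for l = 2, 4, 8. The parameter is an integer while l (|G| + 1) / 4 is *)
(* a rational number, so the equation is stated in rat and forces             *)
(* l (|G| + 1) / 4 to be an integer.                                          *)
Definition type_Hstar B : Prop :=
  exists2 lam : int, difference_family B lam &
    lam%:Q = (\sum_i #|B i|)%N%:R - l%:R * (#|G|%:R + 1) / 4.

End Family.

Definition type_H (D_ : 'I_4 -> {set G}) : Prop :=
  exists2 lam : int, difference_family D_ lam &
    lam = (\sum_i #|D_ i|)%N%:Z - #|G|%:Z.

(* The indices 0, 1, 2, 3 below are elements of 'I_4 = Z/4. *)
Definition cross_sum (D_ : 'I_4 -> {set G}) : gring G :=
  gset (D_ 0) * gset (setN (D_ 2)) + gset (D_ 2) * gset (setN (D_ 0)) +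
  gset (D_ 1) * gset (setN (D_ 3)) + gset (D_ 3) * gset (setN (D_ 1)).

Definition cond_c1 (D_ : 'I_4 -> {set G}) : Prop :=
  cross_sum D_ = gset setT *~ ((\sum_i #|D_ i|)%N%:Z - #|G|%:Z).

Definition cond_d1 (D_ : 'I_4 -> {set G}) : Prop := 0 \notin \bigcup_i D_ i.

Definition cond_d2 (D_ : 'I_4 -> {set G}) : Prop :=
  exists E0 E1 : {set G},
    [/\ E0 \subset [set~ 0], E1 \subset [set~ 0],
        gset (D_ 0) + gset (D_ 1) - gset (D_ 2) - gset (D_ 3) =
          gset E0 - gset (cobar E0),
        gset (D_ 0) + gset (D_ 3) - gset (D_ 1) - gset (D_ 2) =
          gset E1 - gset (cobar E1) &
        type_Hstar (tnth [tuple E0; E1; cobar E0; cobar E1])].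

Definition cond_d3 (D_ : 'I_4 -> {set G}) : Prop :=
  cross_sum D_ = gset setT *~ ((\sum_i #|D_ i|)%N%:Z - #|G|%:Z + 1).

Definition cond_d5 (D_ : 'I_4 -> {set G}) : Prop :=
  (#|D_ 0%R| + #|D_ 3%R| = #|D_ 1%R| + #|D_ 2%R|)%N.

End GroupRing.

(* Main.v *)
Require Import Defs.
From HB Require Import structures.
From mathcomp Require Import all_boot all_order all_algebra.
From mathcomp Require Import ring zify.

(* Replace a block D by the +-1 element psi D = G - 2 D of Z[G]. A family is of
   type H iff the autocorrelations psi D psi D^(-1) add up to 4 |G|, and of type
   H_l^* iff they add up to l (|G| + 1) - l G; (c1) and (d3) say that the cross
   sum of the psi D_i is 0, resp. 4 G. For (1), (2), (3) a block of G x Z_n is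
   given by its n layers, which are blocks of the given families and their
   complements, arranged so that the correlations between layers at any nonzero
   distance add up to -4 G.
   For (4), write d_i = psi D_i and put
     q0 = (d0 + d1 + d2 + d3)/2,  q1 = (d0 + d1 - d2 - d3)/2,
     q2 = (d0 - d1 + d2 - d3)/2,  q3 = (d0 - d1 - d2 + d3)/2,
   and define p0, p1, p2, p3 in the same way on N. By (d2), q1^2 + q3^2 equals
   2 |G| - 2 G, hence q0^2 + q2^2 equals 2 |G| + 2 G, so the four elements
     h = (q1 p0 + q3 p2 +- (q0 p1 - q2 p3))/2, (q3 p0 - q1 p2 +- (q0 p3 + q2 p1))/2
   have squares adding up to 4 |G| |N| - 4 G N. They vanish at 0 and are +-1
   elsewhere, so the eight elements 1 + h and 1 - h are psi of the new blocks. *)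

Set Implicit Arguments.
Unset Strict Implicit.
Unset Printing Implicit Defensive.

Import GRing.Theory Num.Theory.
Local Open Scope ring_scope.

(** * Sign elements of the group ring and their autocorrelations *)

Section SignElements.
Variable G : finZmodType.
Implicit Types (a b : gring G) (A B : {set G}).

Lemma gringP a b : gcoef a =1 gcoef b -> a = b.
Proof. by move=> ab; apply: val_inj; apply/ffunP. Qed.

Lemma gcoefD a b x : gcoef (a + b) x = gcoef a x + gcoef b x.
Proof. by rewrite ffunE. Qed.

Lemma gcoefN a x : gcoef (- a) x = - gcoef a x.
Proof. by rewrite ffunE. Qed.

Lemma gcoef0 x : gcoef (0 : gring G) x = 0.
Proof. by rewrite ffunE. Qed.

Lemma gcoef1 x : gcoef (1 : gring G) x = (x == 0)%:R.
Proof. by rewrite ffunE. Qed.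

Lemma gcoefM a b x : gcoef (a * b) x = \sum_y gcoef a y * gcoef b (x - y).
Proof. by rewrite ffunE. Qed.

Lemma gcoefMn a n x : gcoef (a *+ n) x = gcoef a x *+ n.
Proof.
by elim: n => [|n IHn]; rewrite ?mulr0n ?gcoef0 // !mulrSr gcoefD IHn.
Qed.

Lemma gcoef_sum (I : finType) (F : I -> gring G) x :
  gcoef (\sum_i F i) x = \sum_i gcoef (F i) x.
Proof. by elim/big_rec2: _ => [|i y z _ <-]; rewrite ?gcoef0 ?gcoefD. Qed.

Lemma gcoef_set A x : gcoef (gset A) x = (x \in A)%:R.
Proof. by rewrite ffunE. Qed.

Definition gcoefE :=
  (gcoefD, gcoefN, gcoef0, gcoef1, gcoefMn, gcoef_set).

(** Z[G] is torsion-free. This replaces division: identities involving halves or quarters are proved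
    after multiplication by an integer. *)
Lemma gring_mulIn n a b : (0 < n)%N -> a *+ n = b *+ n -> a = b.
Proof.
move=> n_gt0 eqn; apply: gringP => x.
have := congr1 (fun c => gcoef c x) eqn; rewrite !gcoefMn => /eqP.
by rewrite eqr_pMn2r // => /eqP.
Qed.

Lemma gset1 : gset [set 0] = 1 :> gring G.
Proof. by apply: gringP => x; rewrite !gcoefE inE. Qed.

Lemma gset1M (x y : G) : gset [set x] * gset [set y] = gset [set x + y].
Proof.
apply: gringP => z; rewrite gcoefM (bigD1 x) //= big1 => [|u /negPf ux].
  by rewrite !gcoefE !inE eqxx mul1r addr0 subr_eq addrC.
by rewrite !gcoefE inE ux mul0r.
Qed.

Definition gstar a : gring G := GRingElt [ffun x => gcoef a (- x)].

Lemma gcoef_star a x : gcoef (gstar a) x = gcoef a (- x).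
Proof. by rewrite ffunE. Qed.

Fact gstar_is_zmod_morphism : zmod_morphism gstar.
Proof. by move=> a b; apply: gringP => x; rewrite !(gcoef_star, gcoefE). Qed.

Fact gstar_is_monoid_morphism : monoid_morphism gstar.
Proof.
split=> [|a b]; apply: gringP => x.
  by rewrite !(gcoef_star, gcoefE) oppr_eq0.
rewrite !(gcoef_star, gcoefM) (reindex_inj oppr_inj) /=.
by apply: eq_bigr => y _; rewrite !gcoef_star opprB opprK addrC.
Qed.

HB.instance Definition _ :=
  GRing.isZmodMorphism.Build (gring G) (gring G) gstar gstar_is_zmod_morphism.
HB.instance Definition _ :=
  GRing.isMonoidMorphism.Build (gring G) (gring G) gstar
    gstar_is_monoid_morphism.

Lemma in_setN A x : (x \in setN A) = (- x \in A).
Proof.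
apply/imsetP/idP => [[y yA ->]|xA]; first by rewrite opprK.
by exists (- x); rewrite ?opprK.
Qed.

Lemma gset_setN A : gset (setN A) = gstar (gset A).
Proof. by apply: gringP => x; rewrite !(gcoef_star, gcoefE) in_setN. Qed.

Lemma gset_mulT A : gset A * gset [set: G] = gset [set: G] *+ #|A|.
Proof.
apply: gringP => x; rewrite gcoefM !gcoefE inE.
under eq_bigr do rewrite !gcoefE inE mulr1.
rewrite -natr_sum -sum1_card [in RHS]big_mkcond /=; congr _%:R.
Qed.

Lemma gstarT : gstar (gset [set: G]) = gset [set: G].
Proof. by apply: gringP => x; rewrite !(gcoef_star, gcoefE) !inE. Qed.

Definition psi A : gring G := gset [set: G] - gset A *+ 2.

Lemma gcoef_psi A x : gcoef (psi A) x = if x \in A then -1 else 1.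
Proof. by rewrite !gcoefE inE; case: (x \in A). Qed.

Lemma psiC A : psi (~: A) = - psi A.
Proof.
apply: gringP => x; rewrite gcoefN !gcoef_psi inE.
by case: (x \in A); rewrite ?opprK.
Qed.

Lemma psi_symm A : gstar (psi A) = psi A <-> A = setN A.
Proof.
split=> [eqA|eqA]; last first.
  by rewrite /psi rmorphB rmorphMn /= gstarT -gset_setN -eqA.
apply/setP => x; rewrite in_setN.
have := congr1 (fun a => gcoef a x) eqA; rewrite gcoef_star !gcoef_psi.
by case: (x \in A); case: (- x \in A).
Qed.

(** Expand (G - 2 A)(G - 2 B^(-1)) and use A G = |A| G. *)
Lemma psiM A B :
  psi A * gstar (psi B) =
    gset [set: G] *~ (#|G|%:Z - 2 * (#|A|%:Z + #|B|%:Z))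
    + (gset A * gset (setN B)) *+ 4.
Proof.
have cardN : #|setN B| = #|B| by rewrite card_imset //; exact: oppr_inj.
have TT := gset_mulT setT; have AT := gset_mulT A.
have := gset_mulT (setN B); rewrite cardN => BT.
rewrite cardsT in TT.
rewrite gset_setN in BT *.
rewrite /psi rmorphB rmorphMn /= gstarT.
set T := gset [set: G] in TT AT BT *; set X := gset A in AT *.
set Y := gstar _ in BT *.
have -> : (T - X *+ 2) * (T - Y *+ 2) =
    T * T - X * T *+ 2 - Y * T *+ 2 + X * Y *+ 4 by ring.
rewrite TT AT BT; ring.
Qed.

Section Families.
Variables (l : nat) (B : 'I_l -> {set G}).

Lemma sum_psiM :
  \sum_i psi (B i) * gstar (psi (B i)) =
    gset [set: G] *~ (l%:Z * #|G|%:Z - 4 * (\sum_i #|B i|)%N%:Z)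
    + (\sum_i gset (B i) * gset (setN (B i))) *+ 4.
Proof.
rewrite (eq_bigr _ (fun i _ => psiM (B i) (B i))).
rewrite big_split /= -mulrz_sumr -sumrMnl; congr (_ *~ _ + _).
rewrite sumrB sumr_const card_ord; congr (_ - _); first by ring.
rewrite (big_morph Posz PoszD (erefl 0%:Z)) mulr_sumr.
by apply: eq_bigr => i _; ring.
Qed.

Lemma Hstar_lamE (lam : int) (k g : nat) :
  (lam%:Q = k%:R - l%:R * (g%:R + 1) / 4) <->
  (4 * lam = 4 * k%:Z - l%:Z * (g%:Z + 1)).
Proof.
split=> [eqlam|/(congr1 (fun z : int => z%:Q))].
  apply: (@intr_inj rat); rewrite !(rmorphB, rmorphM, rmorphD) /= eqlam.
  by rewrite -!pmulrn; field.
rewrite !(rmorphB, rmorphM, rmorphD) /= -!pmulrn => eqlam.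
have -> : lam%:Q = (4 * lam%:Q) / 4 by field.
by rewrite eqlam; field.
Qed.

(** With k the sum of the block sizes, [sum_psiM] gives G the coefficient l |G| - 4 k + 4 lam = - l
    and gives 1 the coefficient 4 (k - lam) = l (|G| + 1). *)
Lemma Hstar_psi : type_Hstar B ->
  \sum_i psi (B i) * gstar (psi (B i)) = (l * #|G|.+1)%:R - gset [set: G] *+ l.
Proof.
case=> lam dfB /Hstar_lamE eqlam; rewrite sum_psiM dfB gset1.
set k := (\sum_i _)%N in eqlam *.
have -> : (gset [set: G] *~ lam + 1 *~ (k%:Z - lam)) *+ 4 =
  gset [set: G] *~ (4 * lam) + 1 *~ (4 * k%:Z - 4 * lam) by ring.
rewrite eqlam; ring.
Qed.

(** Since 4 divides l, the parameter lam = k - m (|G| + 1) is an integer; the factor 4 in [sum_psiM]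
    is then cancelled. *)
Lemma psi_Hstar m : l = (4 * m)%N ->
  \sum_i psi (B i) * gstar (psi (B i)) = (l * #|G|.+1)%:R - gset [set: G] *+ l ->
  type_Hstar B.
Proof.
move=> def_l; rewrite sum_psiM; set k := (\sum_i _)%N => eqB.
exists (k%:Z - m%:Z * (#|G|%:Z + 1)); last first.
  have lZ : l%:Z = 4 * m%:Z by rewrite def_l PoszM.
  by apply/Hstar_lamE; rewrite lZ; ring.
apply: (@gring_mulIn 4) => //; rewrite -/k gset1.
apply: (addrI (gset [set: G] *~ (l%:Z * #|G|%:Z - 4 * k%:Z))); rewrite eqB def_l.
by rewrite PoszM; ring.
Qed.

End Families.

Lemma big_ord4 (R : nmodType) (F : 'I_4 -> R) :
  \sum_i F i = F 0 + F 1 + F 2 + F 3.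
Proof.
rewrite !big_ord_recl big_ord0 addr0 !addrA.
by congr (_ + F _ + F _ + F _); apply: val_inj.
Qed.

Lemma H_psi (D : 'I_4 -> {set G}) : type_H D ->
  psi (D 0) * gstar (psi (D 0)) + psi (D 1) * gstar (psi (D 1))
  + psi (D 2) * gstar (psi (D 2)) + psi (D 3) * gstar (psi (D 3))
  = (4 * #|G|)%:R.
Proof.
case=> lam dfD def_lam.
rewrite -(big_ord4 (fun i => psi (D i) * gstar (psi (D i)))) sum_psiM dfD.
by rewrite def_lam gset1; ring.
Qed.

(** The case [c = 0] is (c1), the case [c = 1] is (d3). *)
Lemma cross_psi (D : 'I_4 -> {set G}) (c : int) :
  cross_sum D = gset [set: G] *~ ((\sum_i #|D i|)%N%:Z - #|G|%:Z + c) ->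
  psi (D 0) * gstar (psi (D 2)) + psi (D 2) * gstar (psi (D 0))
  + psi (D 1) * gstar (psi (D 3)) + psi (D 3) * gstar (psi (D 1))
  = gset [set: G] *~ (4 * c).
Proof.
rewrite /cross_sum big_ord4 !psiM => eqD.
transitivity ((gset (D 0) * gset (setN (D 2)) + gset (D 2) * gset (setN (D 0))
  + gset (D 1) * gset (setN (D 3)) + gset (D 3) * gset (setN (D 1))) *+ 4
  + gset [set: G] *~ (4 * (#|G|%:Z - #|D 0%R|%:Z - #|D 1%R|%:Z
                              - #|D 2%R|%:Z - #|D 3%R|%:Z))).
  by ring.
by rewrite eqD !PoszD; ring.
Qed.

End SignElements.

(** * The group ring of a product group, and blocks given by layers *)

Section Product.
Variables G H : finZmodType.

Definition gten (a : gring G) (b : gring H) : gring (G * H)%type :=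
  GRingElt [ffun p => gcoef a p.1 * gcoef b p.2].

Lemma gcoef_ten a b p : gcoef (gten a b) p = gcoef a p.1 * gcoef b p.2.
Proof. by rewrite ffunE. Qed.

Lemma gtenM a b c d : gten a b * gten c d = gten (a * c) (b * d).
Proof.
apply: gringP => p; rewrite gcoef_ten !gcoefM big_distrlr pair_bigA /=.
by apply: eq_bigr => q _; rewrite !gcoef_ten mulrACA.
Qed.

Lemma gten_star a b : gstar (gten a b) = gten (gstar a) (gstar b).
Proof. by apply: gringP => p; rewrite !(gcoef_star, gcoef_ten). Qed.

Lemma gtenT : gten (gset [set: G]) (gset [set: H]) = gset [set: G * H].
Proof. by apply: gringP => p; rewrite gcoef_ten !gcoefE !inE. Qed.

Lemma gten1 : gten 1 1 = 1.
Proof. by apply: gringP => p; rewrite gcoef_ten !gcoefE -natrM mulnb. Qed.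

(** The ring embeddings of the two factors. By [gtenE] a tensor is a product of embedded elements,
    so [ring] applies to it. *)
Definition ginl a := gten a 1.
Definition ginr b := gten 1 b.

Fact ginl_is_zmod_morphism : zmod_morphism ginl.
Proof.
by move=> a b; apply: gringP => p; rewrite !(gcoef_ten, gcoefD, gcoefN) mulrBl.
Qed.

Fact ginl_is_monoid_morphism : monoid_morphism ginl.
Proof. by split=> [|a b]; rewrite /ginl ?gten1 ?gtenM ?mul1r. Qed.

HB.instance Definition _ :=
  GRing.isZmodMorphism.Build (gring G) (gring (G * H)%type) ginl
    ginl_is_zmod_morphism.
HB.instance Definition _ :=
  GRing.isMonoidMorphism.Build (gring G) (gring (G * H)%type) ginl
    ginl_is_monoid_morphism.

Fact ginr_is_zmod_morphism : zmod_morphism ginr.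
Proof.
by move=> a b; apply: gringP => p; rewrite !(gcoef_ten, gcoefD, gcoefN) mulrBr.
Qed.

Fact ginr_is_monoid_morphism : monoid_morphism ginr.
Proof. by split=> [|a b]; rewrite /ginr ?gten1 ?gtenM ?mul1r. Qed.

HB.instance Definition _ :=
  GRing.isZmodMorphism.Build (gring H) (gring (G * H)%type) ginr
    ginr_is_zmod_morphism.
HB.instance Definition _ :=
  GRing.isMonoidMorphism.Build (gring H) (gring (G * H)%type) ginr
    ginr_is_monoid_morphism.

Lemma gtenE a b : gten a b = ginl a * ginr b.
Proof. by rewrite gtenM mulr1 mul1r. Qed.

Lemma ginl_star a : gstar (ginl a) = ginl (gstar a).
Proof. by rewrite gten_star rmorph1. Qed.

Lemma ginr_star b : gstar (ginr b) = ginr (gstar b).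
Proof. by rewrite gten_star rmorph1. Qed.

Definition layers (A : H -> {set G}) : {set (G * H)%type} :=
  [set p | p.1 \in A p.2].

Lemma psi_layers (A : H -> {set G}) :
  psi (layers A) = \sum_y ginl (psi (A y)) * ginr (gset [set y]).
Proof.
apply: gringP => p; rewrite gcoef_sum (bigD1 p.2) // big1 => [|y /andP[_]].
  rewrite Monoid.mulm1 -gtenE gcoef_ten !gcoef_psi !gcoefE !inE eqxx.
  by rewrite mulr1.
rewrite eq_sym => /negPf yp.
by rewrite -gtenE gcoef_ten [gcoef (gset _) _]gcoef_set inE yp mulr0.
Qed.

(** Two layers at heights k + y and y contribute only at height k, so the autocorrelation is
    collected by the distance k. *)
Lemma psi_layers_autocorrelation (A : H -> {set G}) :
  psi (layers A) * gstar (psi (layers A)) =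
    \sum_k ginl (\sum_y psi (A (k + y)) * gstar (psi (A y)))
            * ginr (gset [set k]).
Proof.
rewrite psi_layers rmorph_sum big_distrlr exchange_big /=.
rewrite [RHS](eq_bigr (fun k => \sum_y ginl (psi (A (k + y)))
    * ginl (gstar (psi (A y))) * ginr (gset [set k]))) => [|k _]; last first.
  by rewrite rmorph_sum mulr_suml; apply: eq_bigr => y _; rewrite rmorphM.
rewrite [RHS]exchange_big /=; apply: eq_bigr => y _.
rewrite (reindex_inj (addIr y)) /=; apply: eq_bigr => k _.
rewrite rmorphM /= ginl_star ginr_star -gset_setN mulrACA -(rmorphM ginr).
congr (_ * ginr _); suff -> : setN [set y] = [set - y] by rewrite gset1M addrK.
by apply/setP => x; rewrite in_setN !inE eqr_oppLR.
Qed.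

(** This is the criterion [psi_Hstar] on G x H, read off at each height k of H. *)
Lemma Hstar_layers l m (A : 'I_l -> H -> {set G}) : l = (4 * m)%N ->
  (forall k, \sum_j \sum_y psi (A j (k + y)) * gstar (psi (A j y)) =
     (if k == 0 then (l * (#|G| * #|H|).+1)%N else 0)%:R - gset [set: G] *+ l) ->
  exists F : 'I_l -> {set (G * H)%type}, type_Hstar F.
Proof.
move=> def_l corrA; exists (fun j => layers (A j)).
apply: (psi_Hstar def_l).
under eq_bigr do rewrite psi_layers_autocorrelation.
rewrite exchange_big /=.
under eq_bigr do rewrite -mulr_suml -rmorph_sum corrA rmorphB rmorph_nat mulrBl.
rewrite sumrB (bigD1 0) // big1 => [|k /andP[_ /negPf ->]]; last by rewrite mul0r.
rewrite Monoid.mulm1 eqxx gset1 rmorph1 mulr1 card_prod; congr (_ - _).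
rewrite -mulr_sumr rmorphMn mulrnAl -gtenT gtenE; congr (_ * _ *+ _).
rewrite -rmorph_sum; congr ginr; apply: gringP => x.
rewrite gcoef_sum gcoefE !inE (bigD1 x) // big1 => [|y /andP[_ /negPf]].
  by rewrite Monoid.mulm1 gcoefE inE eqxx.
by rewrite eq_sym gcoefE inE => ->.
Qed.

End Product.

(** * Extensions by Z_2, Z_3 and Z_5 *)

Section Constructions.
Variable G : finZmodType.
Implicit Types D B : 'I_4 -> {set G}.
Local Notation GG := (gset [set: G]).

Lemma Hstar_Z2 D B : type_H D -> cond_d3 D -> type_Hstar B -> cond_c1 B ->
  exists F : 'I_4 -> {set (G * 'Z_2)%type}, type_Hstar F.
Proof.
move=> /H_psi sumD /(@cross_psi _ D 1) crossD /Hstar_psi sumB c1B.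
have /cross_psi crossB : cross_sum B =
  gset setT *~ ((\sum_i #|B i|)%N%:Z - #|G|%:Z + 0) by rewrite addr0.
rewrite big_ord4 in sumB.
(* Complementing one layer negates the cross terms of D, so distance 1 gives 0 - 4 G; distance 0
   gives 4 |G| + 4 (|G| + 1) - 4 G. *)
pose A (j : 'I_4) (y : 'Z_2) := nth set0 (nth [::]
  [:: [:: D 0; ~: D 2]; [:: D 1; ~: D 3]; [:: B 0; B 2]; [:: B 1; B 3]] j) y.
apply: (@Hstar_layers _ _ 4 1 A) => // k.
rewrite big_ord4 !big_ord_recl !big_ord0 /A card_ord /Zp_trunc.
move: k => [[|[|//]] Hk] /=.
  rewrite !psiC !rmorphN.
  by apply: etrans (etrans _ (congr2 +%R sumD sumB)) _; ring.
rewrite !psiC !rmorphN.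
by apply: etrans (etrans _ (congr2 (fun x y => y - x) crossD crossB)) _; ring.
Qed.

Lemma Hstar_Z3 D (B : 'I_2 -> {set G}) :
  type_H D -> symmetric_family D -> cond_d3 D -> type_Hstar B ->
  exists F : 'I_4 -> {set (G * 'Z_3)%type}, type_Hstar F.
Proof.
move=> /H_psi sumD symD /(@cross_psi _ D 1) crossD /Hstar_psi sumB.
rewrite !big_ord_recl big_ord0 in sumB.
have symm i : gstar (psi (D i)) = psi (D i) by apply/psi_symm.
rewrite !symm in sumD crossD.
have crossD2 : psi (D 0) * psi (D 2) + psi (D 1) * psi (D 3) = GG *+ 2.
  apply: (@gring_mulIn _ 2) => //.
  by apply: etrans (etrans _ crossD) _; ring.
pose b0 := B ord0; pose b1 := B (lift ord0 ord0).
rewrite -/b0 -/b1 in sumB.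
(* The rows come in pairs (b, x, - y), (b, - x, y): the products with b cancel at nonzero distance,
   and each pair leaves - 2 x y. *)
pose A (j : 'I_4) (y : 'Z_3) := nth set0 (nth [::]
  [:: [:: b0; D 0; ~: D 2]; [:: b0; ~: D 0; D 2];
      [:: b1; D 1; ~: D 3]; [:: b1; ~: D 1; D 3]] j) y.
apply: (@Hstar_layers _ _ 4 1 A) => // k.
rewrite big_ord4 !big_ord_recl !big_ord0 /A card_ord /Zp_trunc.
move: k => [[|[|[|//]]] Hk] /=; rewrite !psiC !rmorphN /= !symm.
- by apply: etrans (etrans _ (congr2 (fun x y => (x + y) *+ 2) sumD sumB)) _; ring.
- by apply: etrans (etrans _ (congr1 (fun x => - (x *+ 2)) crossD2)) _; ring.
- by apply: etrans (etrans _ (congr1 (fun x => - (x *+ 2)) crossD2)) _; ring.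
Qed.

(* Here [e = cobar E - E], so that [psi E] and [psi (cobar E)] are [1 + e] and
   [1 - e]; the type [H_4^*] condition becomes the last equation. *)
Lemma cond_d2_psi D : type_H D -> symmetric_family D -> cond_d2 D ->
  let d i := psi (D i) in
  exists E0 E1 : {set G}, exists e0 e1 : gring G,
    [/\ [/\ psi E0 = 1 + e0, psi (cobar E0) = 1 - e0,
        psi E1 = 1 + e1 & psi (cobar E1) = 1 - e1],
        d 0 + d 1 - d 2 - d 3 = e0 *+ 2,
        d 0 + d 3 - d 1 - d 2 = e1 *+ 2 &
        [/\ gstar e0 = e0, gstar e1 = e1 &
          e0 ^+ 2 + e1 ^+ 2 = (2 * #|G|)%:R - GG *+ 2]].
Proof.
move=> HD symD [E0 [E1 [/subsetP E0s /subsetP E1s eq0 eq1 /Hstar_psi]]].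
have symm i : gstar (psi (D i)) = psi (D i) by apply/psi_symm.
have psiE (E : {set G}) (e := gset (cobar E) - gset E) :
    {subset E <= [set~ 0]} -> psi E = 1 + e /\ psi (cobar E) = 1 - e.
  move=> Es; split; apply: gringP => x; rewrite !(gcoef_psi, gcoefE) !inE;
    by have := Es x; rewrite !inE; case: (x == 0); case: (x \in E) => // /(_ isT).
have [] := (psiE E0 E0s, psiE E1 E1s).
set e0 := gset (cobar E0) - gset E0; set e1 := gset (cobar E1) - gset E1.
move=> [pE0 pC0] [pE1 pC1].
have d0E : psi (D 0) + psi (D 1) - psi (D 2) - psi (D 3) = e0 *+ 2.
  rewrite /psi /e0.
  by apply: etrans (etrans _ (congr1 (fun x => - (x *+ 2)) eq0)) _; ring.
have d1E : psi (D 0) + psi (D 3) - psi (D 1) - psi (D 2) = e1 *+ 2.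
  rewrite /psi /e1.
  by apply: etrans (etrans _ (congr1 (fun x => - (x *+ 2)) eq1)) _; ring.
clearbody e0 e1.
(* Twice [e0] is a combination of the symmetric [psi (D i)]. *)
have syme0 : gstar e0 = e0.
  have := congr1 (@gstar G) d0E.
  by rewrite rmorphMn 2!rmorphB rmorphD /= !symm d0E => /gring_mulIn <-.
have syme1 : gstar e1 = e1.
  have := congr1 (@gstar G) d1E.
  by rewrite rmorphMn 2!rmorphB rmorphD /= !symm d1E => /gring_mulIn <-.
rewrite big_ord4 => sumE; exists E0, E1, e0, e1; split=> //; split=> //.
move: sumE; rewrite /tnth /= pE0 pE1 pC0 pC1.
rewrite !rmorphB !rmorphD !rmorph1 /= syme0 syme1 => sumE.
apply: (@gring_mulIn _ 2) => //.
by apply: etrans (etrans _ (congr1 (fun x => x - 4) sumE)) _; ring.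
Qed.

(* The table of blocks in the proof was found by a computer search. *)
Lemma Hstar_Z5 D : type_H D -> symmetric_family D -> cond_d2 D ->
  exists F : 'I_4 -> {set (G * 'Z_5)%type}, type_Hstar F.
Proof.
move=> HD symD /(cond_d2_psi HD symD).
case=> [E0 [E1 [e0 [e1 [[E0e C0e E1e C1e] De0 De1 [syme0 syme1 sume]]]]]].
have symm i : gstar (psi (D i)) = psi (D i) by apply/psi_symm.
have sumD := H_psi HD; rewrite !symm in sumD.
(* With u = d0 - d2 and v = d1 - d3, (d2) reads u + v = 2 e0 and u - v = 2 e1. The squares add up to
   2 (u^2 + v^2), which is twice the sum of the d_i^2 minus 4 (d0 d2 + d1 d3). *)
have crossD : psi (D 0) * psi (D 2) + psi (D 1) * psi (D 3) = GG *+ 2.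
  apply: (@gring_mulIn _ 4) => //.
  have sumDe := congr2 (fun x y => x ^+ 2 + y ^+ 2) De0 De1.
  apply: etrans (etrans _ (congr2 (fun x y => x *+ 2 - y) sumD sumDe)) _.
    by ring.
  by apply: etrans (etrans _ (congr1 (fun x => (8 * #|G|)%:R - x *+ 4) sume)) _; ring.
(* In the same notation, twice the left side is (u + v) v + (u - v) u = u^2 + v^2. *)
have crossDe : e0 * (psi (D 1) - psi (D 3)) + e1 * (psi (D 0) - psi (D 2)) =
    (2 * #|G|)%:R - GG *+ 2.
  apply: (@gring_mulIn _ 2) => //.
  have De := congr2 (fun x y =>
    x * (psi (D 1) - psi (D 3)) + y * (psi (D 0) - psi (D 2))) De0 De1.
  apply: etrans (etrans _ (esym De)) _; first by ring.
  by apply: etrans (etrans _ (congr2 (fun x y => x - y *+ 2) sumD crossD)) _; ring.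
pose A (j : 'I_4) (y : 'Z_5) := nth set0 (nth [::]
  [:: [:: cobar E0; D 1; ~: D 3; D 1; ~: D 3];
      [:: E0; ~: D 1; ~: D 1; D 3; D 3];
      [:: cobar E1; D 0; ~: D 2; D 0; ~: D 2];
      [:: E1; ~: D 0; ~: D 0; D 2; D 2]] j) y.
apply: (@Hstar_layers _ _ 4 1 A) => // k.
rewrite big_ord4 !big_ord_recl !big_ord0 /A card_ord /Zp_trunc.
move: k => [[|[|[|[|[|//]]]]] Hk] /=;
  rewrite !psiC E0e C0e E1e C1e !rmorphN /= !symm !rmorphD !rmorphN !rmorph1;
  rewrite /= syme0 syme1.
- apply: etrans (etrans _ (congr2 (fun x y => x *+ 4 + y *+ 2 + 4) sumD sume)) _.
    by ring.
  by ring.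
(* In the rows with 1 - e and 1 + e the terms linear in the d_i cancel. Each nonzero distance leaves
   [sumD] - 2 [crossDe] - 4 [crossD], that is 4 |G| - (4 |G| - 4 G) - 8 G = - 4 G. *)
all: have corr := congr2 (fun x y => x - y) sumD
  (congr2 (fun x y => (x + y *+ 2) *+ 2) crossDe crossD).
all: by apply: etrans (etrans _ corr) _; ring.
Qed.

End Constructions.

(** * The product of two symmetric families *)

(** Both n + K and n - K equal n at 0 and are n or - n elsewhere, so they are n times sign
    elements. *)
Lemma sign_blocks (G : finZmodType) (K : gring G) (n : nat) : (0 < n)%N ->
  (forall x, `|gcoef K x|%N = if x == 0 then 0%N else n) ->
  exists X Y : {set G}, psi X *+ n = n%:R + K /\ psi Y *+ n = n%:R - K.
Proof.
move=> n_gt0 absK; exists [set x | gcoef K x < 0], [set x | 0 < gcoef K x].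
split; apply: gringP => x; rewrite gcoefD ?gcoefN !gcoefMn gcoef_psi gcoef1 inE;
  by have := absK x; case: (x == 0) => /=; case: ifP; lia.
Qed.

Lemma symmetric_multiple (G : finZmodType) (X : {set G}) a n : (0 < n)%N ->
  psi X *+ n = a -> gstar a = a -> X = setN X.
Proof.
move=> n_gt0 eqX syma; apply/psi_symm; apply: (gring_mulIn n_gt0).
by rewrite -rmorphMn eqX.
Qed.

Section Combinations.
Variable R : comNzRingType.
Implicit Types d : 'I_4 -> R.

(** These are twice the q_i of the opening comment, and the entries of [prod_block] are 8 h; a
    general ring has no halves. *)
Definition comb0 d := d 0 + d 1 + d 2 + d 3.
Definition comb1 d := d 0 + d 1 - d 2 - d 3.
Definition comb2 d := d 0 - d 1 + d 2 - d 3.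
Definition comb3 d := d 0 + d 3 - d 1 - d 2.

Definition prod_block (q p : 'I_4 -> R) : seq R :=
  [:: comb1 q * comb0 p + comb3 q * comb2 p + comb0 q * comb1 p - comb2 q * comb3 p;
      comb1 q * comb0 p + comb3 q * comb2 p - comb0 q * comb1 p + comb2 q * comb3 p;
      comb3 q * comb0 p - comb1 q * comb2 p + comb0 q * comb3 p + comb2 q * comb1 p;
      comb3 q * comb0 p - comb1 q * comb2 p - comb0 q * comb3 p - comb2 q * comb1 p].

End Combinations.

Lemma combE (R S : comNzRingType) (f : {rmorphism R -> S}) (d : 'I_4 -> R) :
  (comb0 (fun i => f (d i)) = f (comb0 d)) *
  (comb1 (fun i => f (d i)) = f (comb1 d)) *
  (comb2 (fun i => f (d i)) = f (comb2 d)) *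
  (comb3 (fun i => f (d i)) = f (comb3 d)).
Proof. by do !split; rewrite !(rmorphB, rmorphD). Qed.

Lemma gcoef_comb (G : finZmodType) (d : 'I_4 -> gring G) x
    (dx := fun i => gcoef (d i) x) :
  (gcoef (comb0 d) x = comb0 dx) * (gcoef (comb1 d) x = comb1 dx) *
  (gcoef (comb2 d) x = comb2 dx) * (gcoef (comb3 d) x = comb3 dx).
Proof. by do !split; rewrite !(gcoefD, gcoefN). Qed.

(* A product of four signs being [-1] amounts to their half sum being a sign;
   this is why the entries of [prod_block] have constant absolute value. *)
Lemma prod_block_abs (x0 y0 : bool) (b c : 'I_4 -> bool) (q p : 'I_4 -> int) :
  (forall i, q i = if b i then -1 else 1) ->
  (forall i, p i = if c i then -1 else 1) ->
  `|comb1 q|%N = (if x0 then 0 else 2)%N -> `|comb3 q|%N = (if x0 then 0 else 2)%N ->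
  `|comb1 p|%N = (if y0 then 0 else 2)%N -> `|comb3 p|%N = (if y0 then 0 else 2)%N ->
  (y0 -> forall i, c i = false) ->
  forall i : 'I_4, `|nth 0%R (prod_block q p) i|%N = if x0 && y0 then 0%N else 8.
Proof.
move=> qE pE q1 q3 p1 p3 c_y0 i.
have {c_y0} : y0 ==> ~~ [|| c 0, c 1, c 2 | c 3].
  by apply/implyP => /c_y0 c0; rewrite !c0.
move: q1 q3 p1 p3; rewrite /prod_block /comb0 /comb1 /comb2 /comb3 !qE !pE.
move: (b 0) (b 1) (b 2) (b 3) (c 0) (c 1) (c 2) (c 3) => b0 b1 b2 b3 c0 c1 c2 c3.
case: i => [[|[|[|[|//]]]] Hi] /=; case: x0; case: y0;
case: b0; case: b1; case: b2; case: b3 => // q1 q3;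
by case: c0; case: c1; case: c2; case: c3.
Qed.

Section Tensor.
Variables G N : finZmodType.
Variables (d : 'I_4 -> gring G) (s : 'I_4 -> gring N).

Local Arguments gcoef : simpl never.

Definition ten_block : seq (gring (G * N)%type) :=
  prod_block (fun i => ginl N (d i)) (fun i => ginr G (s i)).

Lemma gcoef_ten_block (i : 'I_4) z :
  gcoef (nth 0 ten_block i) z =
    nth 0 (prod_block (fun i => gcoef (d i) z.1) (fun i => gcoef (s i) z.2)) i.
Proof.
rewrite /ten_block /prod_block !combE -!gtenE -!gcoef_comb.
by case: i => [[|[|[|[|//]]]] Hi] /=; rewrite !(gcoefD, gcoefN, gcoef_ten).
Qed.

Lemma ten_block_star (i : 'I_4) :
  (forall i, gstar (d i) = d i) -> (forall i, gstar (s i) = s i) ->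
  gstar (nth 0 ten_block i) = nth 0 ten_block i.
Proof.
move=> symd syms.
have [d0 d1 d2 d3] : [/\ gstar (comb0 d) = comb0 d, gstar (comb1 d) = comb1 d,
    gstar (comb2 d) = comb2 d & gstar (comb3 d) = comb3 d].
  by split; rewrite !(rmorphB, rmorphD) /= !symd.
have [s0 s1 s2 s3] : [/\ gstar (comb0 s) = comb0 s, gstar (comb1 s) = comb1 s,
    gstar (comb2 s) = comb2 s & gstar (comb3 s) = comb3 s].
  by split; rewrite !(rmorphB, rmorphD) /= !syms.
rewrite /ten_block /prod_block !combE -!gtenE.
have star_ten a b : gstar a = a -> gstar b = b -> gstar (gten a b) = gten a b.
  by move=> sa sb; rewrite gten_star sa sb.
by case: i => [[|[|[|[|//]]]] Hi] /=; rewrite !(rmorphB, rmorphD) /= !star_ten.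
Qed.

(** The entries are u1 + v1, u1 - v1, u2 + v2, u2 - v2, so the squares add up to 2 (u1^2 + u2^2 +
    v1^2 + v2^2). The two-square identity factors u1^2 + u2^2 and v1^2 + v2^2. *)
Lemma sum_ten_block_sqr :
  \sum_(i < 4) nth 0 ten_block i ^+ 2 =
  (ginl N (comb1 d ^+ 2 + comb3 d ^+ 2) * ginr G (comb0 s ^+ 2 + comb2 s ^+ 2)
   + ginl N (comb0 d ^+ 2 + comb2 d ^+ 2) * ginr G (comb1 s ^+ 2 + comb3 s ^+ 2))
  *+ 2.
Proof.
rewrite big_ord4 /ten_block /prod_block !combE /=.
move: (comb0 d) (comb1 d) (comb2 d) (comb3 d) => d0 d1 d2 d3.
move: (comb0 s) (comb1 s) (comb2 s) (comb3 s) => s0 s1 s2 s3.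
by rewrite !rmorphD !rmorphXn; ring.
Qed.

End Tensor.

Section Symmetric.
Variables (G : finZmodType) (D : 'I_4 -> {set G}).
Let d i := psi (D i).

(** The two combinations are 2 e0 and 2 e1. As 1 + e and 1 - e are both sign elements, e is 0 at 0
    and a sign elsewhere. *)
Lemma comb13_abs x : type_H D -> symmetric_family D -> cond_d2 D ->
  `|comb1 (fun i => gcoef (d i) x)|%N = (if x == 0%R then 0 else 2)%N /\
  `|comb3 (fun i => gcoef (d i) x)|%N = (if x == 0%R then 0 else 2)%N.
Proof.
move=> HD symD d2D; case: (cond_d2_psi HD symD d2D).
move=> E0 [E1 [e0 [e1 [[E0e C0e E1e C1e] De0 De1 _]]]].
have := congr1 (fun a => gcoef a x) (De0 : comb1 d = _).
have := congr1 (fun a => gcoef a x) (De1 : comb3 d = _).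
rewrite !gcoef_comb !gcoefMn => -> ->.
have := congr1 (fun a => gcoef a x) E0e; have := congr1 (fun a => gcoef a x) E1e.
have := congr1 (fun a => gcoef a x) C0e; have := congr1 (fun a => gcoef a x) C1e.
rewrite !gcoef_psi !(gcoefD, gcoefN, gcoef1).
by do 4!case: ifP => _; case: (x == 0) => /=; lia.
Qed.

(** The four combinations form a Hadamard transform of order 4, so their squares add up to 4 times
    the sum of the d_i^2, that is 16 |G|; (d2) gives the share of [comb1] and [comb3]. *)
Lemma comb_sqr : type_H D -> symmetric_family D -> cond_d2 D ->
  comb1 d ^+ 2 + comb3 d ^+ 2 = (8 * #|G|)%:R - gset [set: G] *+ 8 /\
  comb0 d ^+ 2 + comb2 d ^+ 2 = (8 * #|G|)%:R + gset [set: G] *+ 8.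
Proof.
move=> HD symD d2D.
have symm i : gstar (d i) = d i by apply/psi_symm.
have sumD := H_psi HD; rewrite -/(d _) in sumD.
case: (cond_d2_psi HD symD d2D) => E0 [E1 [e0 [e1 [_ De0 De1 [_ _ sume]]]]].
have sum13 : comb1 d ^+ 2 + comb3 d ^+ 2 = (8 * #|G|)%:R - gset [set: G] *+ 8.
  rewrite /comb1 /comb3 De0 De1.
  by apply: etrans (etrans _ (congr1 (fun x => x *+ 4) sume)) _; ring.
split=> //; rewrite !symm in sumD.
apply: etrans (etrans _ (congr2 (fun x y => x *+ 4 - y) sumD sum13)) _.
  by rewrite /comb0 /comb1 /comb2 /comb3 -!/(d _); ring.
by ring.
Qed.

End Symmetric.

Lemma Hstar_product (G N : finZmodType) (D : 'I_4 -> {set G})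
    (S : 'I_4 -> {set N}) :
  type_H D -> symmetric_family D -> cond_d2 D ->
  type_H S -> symmetric_family S -> cond_d1 S -> cond_d2 S ->
  exists2 F : 'I_8 -> {set (G * N)%type}, symmetric_family F & type_Hstar F.
Proof.
move=> HD symD d2D HS symS d1S d2S.
pose d i := psi (D i); pose s i := psi (S i).
pose K (i : 'I_4) : gring (G * N)%type := (ten_block d s)`_i.
have symd i : gstar (d i) = d i by apply/psi_symm.
have syms i : gstar (s i) = s i by apply/psi_symm.
have [sqr13D sqr02D] := comb_sqr HD symD d2D.
have [sqr13S sqr02S] := comb_sqr HS symS d2S.
have symK (i : 'I_4) : gstar (K i) = K i by apply: ten_block_star.
have absK (i : 'I_4) z : `|gcoef (K i) z|%N = if z == 0 then 0%N else 8.
  have [D1 D3] := comb13_abs z.1 HD symD d2D.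
  have [S1 S3] := comb13_abs z.2 HS symS d2S.
  rewrite /K gcoef_ten_block.
  apply: (@prod_block_abs (z.1 == 0) (z.2 == 0) (fun i => z.1 \in D i)
    (fun i => z.2 \in S i)) => //.
  - by move=> j; rewrite gcoef_psi.
  - by move=> j; rewrite gcoef_psi.
  move=> /eqP -> j; apply: contraNF d1S => Sj0; apply/bigcupP.
  by exists j.
have blocks (i : 'I_4) : exists XY : {set (G * N)%type} * {set (G * N)%type},
    psi XY.1 *+ 8 = 8 + K i /\ psi XY.2 *+ 8 = 8 - K i.
  by have [X [Y XY]] := sign_blocks (isT : 0 < 8)%N (absK i); exists (X, Y).
have [XY XYE] := fin_all_exists blocks.
have symXY i : XY i = (setN (XY i).1, setN (XY i).2).
  have [Xi Yi] := XYE i; rewrite [LHS]surjective_pairing.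
  have X8 : gstar (8 + K i) = 8 + K i by rewrite rmorphD /= symK rmorph_nat.
  have Y8 : gstar (8 - K i) = 8 - K i by rewrite rmorphB /= symK rmorph_nat.
  congr (_, _); first exact: symmetric_multiple Xi X8.
  exact: symmetric_multiple Yi Y8.
(* The first four blocks come from 8 + K, the last four from 8 - K. *)
pose F (i : 'I_(4 + 4)) := match split i with
  inl j => (XY j).1 | inr j => (XY j).2 end.
have symF i : F i = setN (F i).
  by rewrite /F; case: (split i) => j; rewrite [in LHS]symXY.
exists F; first exact: symF.
apply: (@psi_Hstar _ 8 F 2) => //.
have symFp i : gstar (psi (F i)) = psi (F i) by apply/psi_symm.
rewrite (eq_bigr (fun i => psi (F i) * psi (F i))) => [|i _]; last first.
  by rewrite symFp.
have -> : \sum_(i < 8) psi (F i) * psi (F i) =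
    \sum_(i < 4) (psi (XY i).1 ^+ 2 + psi (XY i).2 ^+ 2).
  rewrite (@big_split_ord _ _ _ 4 4) big_split /F.
  by congr (_ + _); apply: eq_bigr => i _;
    rewrite ?(unsplitK (inl i)) ?(unsplitK (inr i)) expr2.
(* Scaling by 64 = 8^2 turns each pair of blocks into (8 + K)^2 + (8 - K)^2 = 128 + 2 K^2. In the
   sum of the K^2 the mixed terms |G| N and |N| G cancel, leaving 256 (|G| |N| - G N). *)
apply: (@gring_mulIn _ 64); first by [].
transitivity (\sum_(i < 4) (128 + K i ^+ 2 *+ 2)).
  rewrite -sumrMnl; apply: eq_bigr => i _; have [Xi Yi] := XYE i.
  have XY2 := congr2 (fun x y => x ^+ 2 + y ^+ 2) Xi Yi.
  apply: etrans (etrans _ XY2) _.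
    by ring.
  by ring.
rewrite big_split /= sumr_const card_ord sumrMnl sum_ten_block_sqr.
rewrite -/(comb1 d) sqr13D sqr02D sqr13S sqr02S card_prod -gtenT gtenE.
by ring.
Qed.

Theorem theorem1p8 (G : finZmodType) (D : 'I_4 -> {set G}) (hD : type_H D) :
  [/\ cond_d3 D ->
      (exists2 B : 'I_4 -> {set G}, type_Hstar B & cond_c1 B) ->
      exists F : 'I_4 -> {set (G * 'Z_2)%type}, type_Hstar F,
      symmetric_family D -> cond_d3 D ->
      (exists B : 'I_2 -> {set G}, type_Hstar B) ->
      exists F : 'I_4 -> {set (G * 'Z_3)%type}, type_Hstar F,
      symmetric_family D -> cond_d2 D -> cond_d5 D ->
      exists F : 'I_4 -> {set (G * 'Z_5)%type}, type_Hstar F &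
      symmetric_family D -> cond_d2 D ->
      forall N : finZmodType,
      (exists S : 'I_4 -> {set N},
         [/\ symmetric_family S, type_H S, cond_d1 S & cond_d2 S]) ->
      exists2 F : 'I_8 -> {set (G * N)%type},
        symmetric_family F & type_Hstar F].
Proof.
split.
- by move=> d3D [B HB c1B]; exact: Hstar_Z2 hD d3D HB c1B.
- by move=> symD d3D [B HB]; exact: Hstar_Z3 hD symD d3D HB.
- by move=> symD d2D _; exact: Hstar_Z5 hD symD d2D.
- move=> symD d2D N [S [symS HS d1S d2S]].
  exact: Hstar_product hD symD d2D HS symS d1S d2S.
Qed.
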